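(* Suppose that the multi-tile functional equation $$A(T_i)=\bigcup_{j=1}^n(T_j+\mathcal{D}_{ji}),\qquad 1\le i\le n,$$ with primitive subdivision matrix $S=[|\mathcal{D}_{ij}|]_{1\le i,j\le n}$ has a nonempty solution $(T_1,\dots,T_n)$ consisting of compact sets, in which at least one $T_i$ has positive Lebesgue measure. Then $$\lambda(S)\ge|\det(A)|.$$
   Context: $d,n\ge1$ are integers, $A$ is an expanding real $d\times d$ matrix (all eigenvalues, real or complex, have absolute value $>1$), and $\mathcal{D}_{ij}\subset\mathbb{R}^d$, $1\le i,j\le n$, are finite, possibly empty, sets. The $T_i$ are subsets of $\mathbb{R}^d$, $T+\mathcal{D}=\{\mathbf{t}+\mathbf{d}:\mathbf{t}\in T,\mathbf{d}\in\mathcal{D}\}$, and unions are ordinary set unions. A nonnegative real square matrix is primitive if some power has all entries strictly positive; its Perron eigenvalue $\lambda(\cdot)$ is its positive real simple eigenvalue equal to its spectral radius. *)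

(* Defs.v *)
From HB Require Import structures.
From mathcomp Require Export all_boot all_order all_algebra finmap.
From mathcomp Require Export all_classical all_reals all_analysis.
From mathcomp Require Export complex.

Set Implicit Arguments.
Unset Strict Implicit.
Unset Printing Implicit Defensive.

Export Order.TTheory GRing.Theory Num.Theory numFieldNormedType.Exports.

Local Open Scope classical_set_scope.
Local Open Scope ring_scope.

(* The eigenvalues in C of a real matrix, real ones included. *)
Definition complex_eigenvalue (R : realType) (n : nat) (M : 'M[R]_n) :
    pred R[i] :=
  eigenvalue (map_mx (real_complex R) M).

Definition expanding (R : realType) (d : nat) (A : 'M[R]_d) : Prop :=
  forall z : R[i], complex_eigenvalue A z -> 1 < `|z|.

(* The exponent 0 has to be excluded, since M ^+ 0 is the identity, which is
   entrywise positive when n = 1. *)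
Definition primitive_mx (R : realType) (n : nat) (M : 'M[R]_n) : Prop :=
  (forall i j, 0 <= M i j) /\
  exists2 k : nat, (0 < k)%N & forall i j, 0 < (M ^+ k) i j.

(* The norm on R[i] takes its values in R[i]; complex.Re brings them to R. *)
Definition spectral_radius (R : realType) (n : nat) (M : 'M[R]_n) : R :=
  sup [set complex.Re `|z| | z in [set z : R[i] | complex_eigenvalue M z]].

(* Simple means of algebraic multiplicity one. *)
Definition is_perron_eigenvalue (R : realType) (n : nat) (M : 'M[R]_n)
    (l : R) : Prop :=
  [/\ 0 < l, eigenvalue M l, mup l (char_poly M) = 1%N
    & l = spectral_radius M].

(* At most one l satisfies the predicate; for a primitive matrix there is one
   by the Perron-Frobenius theorem. The default 0 is for matrices having none. *)
Definition perron_eigenvalue (R : realType) (n : nat) (M : 'M[R]_n) : R :=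
  xget 0 [set l | is_perron_eigenvalue M l].

Definition box (R : realType) (d : nat) (a b : 'cV[R]_d) : set 'cV[R]_d :=
  [set x | forall k, a k 0 <= x k 0 <= b k 0].

Definition box_volume (R : realType) (d : nat) (a b : 'cV[R]_d) : R :=
  \prod_k (b k 0 - a k 0).

(* Lebesgue outer measure on R^d: the infimum of the total volumes of countable
   covers by closed boxes. Lebesgue measure is its restriction to the
   Lebesgue measurable sets, which include all compact sets. *)
Definition lebesgue_rd (R : realType) (d : nat) (X : set 'cV[R]_d) : \bar R :=
  ereal_inf [set y | exists a b : nat -> 'cV[R]_d,
    [/\ forall m k, a m k 0 <= b m k 0,
        X `<=` \bigcup_m box (a m) (b m)
      & y = (\sum_(m <oo) (box_volume (a m) (b m))%:E)%E]].

Definition set_translates (R : realType) (d : nat) (T : set 'cV[R]_d)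
    (D : {fset 'cV[R]_d}) : set 'cV[R]_d :=
  [set t + e | t in T & e in [set` D]].

Definition subdivision_mx (R : realType) (d n : nat)
    (D : 'I_n -> 'I_n -> {fset 'cV[R]_d}) : 'M[R]_n :=
  \matrix_(i, j) (#|` D i j|)%:R.

Definition multi_tile_equation (R : realType) (d n : nat) (A : 'M[R]_d)
    (D : 'I_n -> 'I_n -> {fset 'cV[R]_d}) (T : 'I_n -> set 'cV[R]_d) : Prop :=
  forall i, [set A *m x | x in T i] = \bigcup_j set_translates (T j) (D j i).

(* Main.v *)
From HB Require Import structures.
Require Import Defs.
From mathcomp Require Import perm zify ring lra.

Set Implicit Arguments.
Unset Strict Implicit.
Unset Printing Implicit Defensive.

Local Open Scope classical_set_scope.
Local Open Scope ring_scope.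

(** Let m be the vector of volumes of the T_i. Taking volumes in the functional
    equation gives the entrywise inequality |det A| m <= m S
    ([multi_tile_volume_le]): the left side is at most the volume of A(T_i), the
    right side at least that volume, by countable subadditivity and translation
    invariance. Pair both sides with a strictly positive column u such that
    S u = l u, where l is the Perron eigenvalue: |det A| (m u) <= l (m u).
    Since m is finite (the T_i are bounded), nonnegative and nonzero, m u is a
    positive real number and can be cancelled.

    Two classical theories have to be supplied.

    - Volume is multiplied by at most |det B| by an invertible linear map B
      ([scales_volume_mulmx]); the reverse inequality follows by applying this
      to the inverse of B. Only outer measure is involved, so upper bounds on
      the images of boxes suffice. The property is stable under products, and
      an LUP decomposition reduces it to permutation matrices, diagonal
      matrices and elementary shears; a shear of a box is covered by thin
      slabs whose total volume tends to that of the box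
      ([lebesgue_rd_shear_box]).

    - The Perron-Frobenius theorem ([primitive_perron]) says that l exists,
      with all the properties required of a Perron eigenvalue. A positive
      eigenvector comes from maximizing the Collatz-Wielandt bound over the
      simplex ([positive_left_eigenvector]), its transposed version gives u,
      and pairing absolute values with u shows that no complex eigenvalue is
      larger. For the simplicity, deflating M into M - u p, with p and u the
      left and right eigenvectors, moves exactly one root l of the
      characteristic polynomial to l - p u ([char_poly_deflation]), while l is
      no longer an eigenvalue of M - u p ([perron_deflation_Neigenvalue]). *)

(** * Lebesgue outer measure *)

Lemma box_volume_ge0 (R : realType) (d : nat) (a b : 'cV[R]_d) :
  (forall k, a k 0 <= b k 0) -> 0 <= box_volume a b.
Proof. by move=> ab; apply: prodr_ge0 => k _; rewrite subr_ge0. Qed.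

(** A nonempty box determines its two corners, so its volume does not depend on
    how it is written. *)
Lemma box_inj (R : realType) (d : nat) (a b a' b' : 'cV[R]_d) :
  (forall k, a k 0 <= b k 0) -> (forall k, a' k 0 <= b' k 0) ->
  box a b = box a' b' -> a = a' /\ b = b'.
Proof.
move=> ab ab' E.
have Ba : box a' b' a by rewrite -E => k; rewrite lexx ab.
have Bb : box a' b' b by rewrite -E => k; rewrite lexx ab.
have Ba' : box a b a' by rewrite E => k; rewrite lexx ab'.
have Bb' : box a b b' by rewrite E => k; rewrite lexx ab'.
split; apply/matrixP => k l; rewrite ord1; apply/eqP; rewrite eq_le.
  by case/andP: (Ba k) => -> _; case/andP: (Ba' k) => -> _.
by case/andP: (Bb k) => _ ->; case/andP: (Bb' k) => _ ->.
Qed.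

(** The volume of a box as a set function, infinite on the sets that are not
    boxes: the outer measure generated by it in the sense of [mu_ext] is
    [lebesgue_rd], which therefore inherits countable subadditivity. *)
Definition box_content (R : realType) (d : nat) (X : set 'cV[R]_d) : \bar R :=
  ereal_inf [set (box_volume p.1 p.2)%:E | p in
    [set p : 'cV[R]_d * 'cV[R]_d |
      (forall k, p.1 k 0 <= p.2 k 0) /\ X = box p.1 p.2]].

Lemma box_contentE (R : realType) (d : nat) (a b : 'cV[R]_d) :
  (forall k, a k 0 <= b k 0) -> box_content (box a b) = (box_volume a b)%:E.
Proof.
move=> ab; rewrite /box_content -[RHS]ereal_inf1; congr ereal_inf.
apply/seteqP; split=> [_ [[a' b'] /= [ab' /(box_inj ab ab')[<- <-]] <-]//|_ ->].
by exists (a, b).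
Qed.

Lemma box_content_ge0 (R : realType) (d : nat) (X : set 'cV[R]_d) :
  (0 <= box_content X)%E.
Proof.
apply: le_ereal_inf_tmp => _ [p [ab _] <-].
by rewrite lee_fin box_volume_ge0.
Qed.

Lemma box_content_fin (R : realType) (d : nat) (X : set 'cV[R]_d) :
  box_content X != +oo%E ->
  exists a b : 'cV[R]_d, (forall k, a k 0 <= b k 0) /\ X = box a b.
Proof.
move=> fin; apply: contrapT => /forallNP H; case/eqP: fin.
suff -> : box_content X = ereal_inf set0 by rewrite ereal_inf0.
congr ereal_inf; apply/seteqP; split=> // y [[a b] [ab XE] _].
by apply: (H a); exists b.
Qed.

(** [mu_ext] takes covers by sets of a semiring; the discrete sigma-algebra
    stands in for it, because covers containing a set that is not a box have
    infinite total content and leave the infimum unchanged. *)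
Lemma lebesgue_rd_mu_ext (R : realType) (d : nat) :
  @lebesgue_rd R d =
  @mu_ext _ (g_sigma_algebraType [set: set 'cV[R]_d]) R (@box_content R d).
Proof.
apply/funext => X; apply/eqP; rewrite eq_le; apply/andP; split.
- apply: le_ereal_inf_tmp => _ [B [_ XB] <-].
  have [[k Bk]|/forallNP Bfin] := pselect (exists k, box_content (B k) = +oo%E).
    rewrite (eseries_pinfty _ _ Bk) ?leey// => n _.
    by rewrite -ltNye (lt_le_trans _ (box_content_ge0 _)).
  have /choice[p pP] : forall k, exists p : 'cV[R]_d * 'cV[R]_d,
      (forall i, p.1 i 0 <= p.2 i 0) /\ B k = box p.1 p.2.
    by move=> k; have /eqP/box_content_fin[a [b ?]] := Bfin k; exists (a, b).
  apply: ereal_inf_lbound; exists (fun k => (p k).1), (fun k => (p k).2); split.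
  + by move=> m; case: (pP m).
  + apply: subset_trans XB _ => x [k _ Bx]; exists k => //.
    by case: (pP k) => _ <-.
  + by apply: eq_eseriesr => k _; case: (pP k) => ? ->; rewrite box_contentE.
- apply: le_ereal_inf_tmp => _ [a [b [ab Xab ->]]].
  apply: ereal_inf_lbound; exists (fun m => box (a m) (b m)).
    by split => // k; exact: sub_sigma_algebra.
  by apply: eq_eseriesr => k _; rewrite box_contentE.
Qed.

Lemma lebesgue_rd_ge0 (R : realType) (d : nat) (X : set 'cV[R]_d) :
  (0 <= lebesgue_rd X)%E.
Proof. by rewrite lebesgue_rd_mu_ext mu_ext_ge0//; exact: box_content_ge0. Qed.

Lemma lebesgue_rd_le (R : realType) (d : nat) :
  {homo @lebesgue_rd R d : X Y / X `<=` Y >-> (X <= Y)%E}.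
Proof. by rewrite lebesgue_rd_mu_ext => X Y XY; exact: le_mu_ext. Qed.

Lemma lebesgue_rd_sigma_subadditive (R : realType) (d : nat) :
  sigma_subadditive (@lebesgue_rd R d).
Proof.
rewrite lebesgue_rd_mu_ext.
exact: (@mu_ext_sigma_subadditive _
  (g_sigma_algebraType [set: set 'cV[R]_d]) R _ (@box_content_ge0 R d)).
Qed.

(** The cover consists of the box and of copies of the point 0, whose volume
    vanishes because the dimension is positive: in dimension 0 the empty product
    makes a point have volume 1, and countable covers infinite volume. *)
Lemma lebesgue_rd_box (R : realType) (d : nat) (a b : 'cV[R]_d.+1) :
  (forall k, a k 0 <= b k 0) ->
  (lebesgue_rd (box a b) <= (box_volume a b)%:E)%E.
Proof.
move=> ab; apply: ereal_inf_lbound.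
exists (fun m => if m == 0%N then a else 0),
  (fun m => if m == 0%N then b else 0).
split=> [[|m] k //|x xab|]; first by exists 0%N.
rewrite nneseries_recl//; last first.
  by move=> [|m] _; rewrite lee_fin box_volume_ge0.
rewrite eseries0 ?adde0// => -[//|m] _ _.
by rewrite /box_volume big_ord_recl !mxE subr0 mul0r.
Qed.

Lemma lebesgue_rd0 (R : realType) (d : nat) :
  @lebesgue_rd R d.+1 set0 = 0%E.
Proof.
apply/eqP; rewrite eq_le lebesgue_rd_ge0 andbT.
apply: (@le_trans _ _ (lebesgue_rd (box (0 : 'cV[R]_d.+1) 0))).
  exact: lebesgue_rd_le.
apply: le_trans (lebesgue_rd_box _) _ => //.
by rewrite /box_volume big_ord_recl !mxE subr0 mul0r.
Qed.

HB.instance Definition _ (R : realType) (d : nat) :=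
  isOuterMeasure.Build R 'cV[R]_d.+1 (@lebesgue_rd R d.+1) (@lebesgue_rd0 R d)
    (@lebesgue_rd_ge0 R d.+1) (@lebesgue_rd_le R d.+1)
    (@lebesgue_rd_sigma_subadditive R d.+1).

Lemma lebesgue_rd_bigsetU (R : realType) (d : nat) (I : Type) (s : seq I)
    (F : I -> set 'cV[R]_d.+1) :
  (lebesgue_rd (\big[setU/set0]_(i <- s) F i) <=
   \sum_(i <- s) lebesgue_rd (F i))%E.
Proof.
elim: s => [|i s IH]; first by rewrite !big_nil lebesgue_rd0.
by rewrite !big_cons (le_trans (outer_measureU2 _ _ _))// leeD2l.
Qed.

(** * Effect of linear maps on volume *)

(** An upper bound for all sets, measurable or not; for an invertible linear map
    the matching lower bound comes from the inverse map. *)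
Definition scales_volume (R : realType) (d : nat)
    (f : 'cV[R]_d -> 'cV[R]_d) (c : R) : Prop :=
  forall X, (lebesgue_rd (f @` X) <= c%:E * lebesgue_rd X)%E.

Lemma scales_volume_comp (R : realType) (d : nat) (f g : 'cV[R]_d -> 'cV[R]_d)
    (c e : R) : 0 <= c ->
  scales_volume f c -> scales_volume g e -> scales_volume (f \o g) (c * e).
Proof.
move=> c0 fc ge X; rewrite -image_comp EFinM -muleA.
by apply: le_trans (fc _) _; rewrite lee_wpmul2l// lee_fin.
Qed.

(** Boxes are enough: map the boxes of a cover of X and use countable
    subadditivity. *)
Lemma scales_volume_box (R : realType) (d : nat)
    (f : 'cV[R]_d.+1 -> 'cV[R]_d.+1) (c : R) : 0 < c ->
  (forall a b : 'cV[R]_d.+1, (forall k, a k 0 <= b k 0) ->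
    (lebesgue_rd (f @` box a b) <= (c * box_volume a b)%:E)%E) ->
  scales_volume f c.
Proof.
move=> c0 fbox X; rewrite -lee_pdivrMl//.
apply: le_ereal_inf_tmp => _ [a [b [ab Xab ->]]]; rewrite lee_pdivrMl//.
rewrite -nneseriesZl; last by move=> k _; rewrite lee_fin box_volume_ge0.
apply: (@le_trans _ _ (lebesgue_rd (\bigcup_m (f @` box (a m) (b m))))).
  apply: lebesgue_rd_le => _ [x /Xab[m _ xm] <-].
  by exists m => //; exists x.
apply: le_trans (lebesgue_rd_sigma_subadditive _) _.
by apply: lee_nneseries => [k _ _|k _]; [exact: lebesgue_rd_ge0|exact: fbox].
Qed.

Lemma scales_volume_sub_box (R : realType) (d : nat)
    (f : 'cV[R]_d.+1 -> 'cV[R]_d.+1) (c : R) : 0 < c ->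
  (forall a b : 'cV[R]_d.+1, (forall k, a k 0 <= b k 0) ->
    exists a' b' : 'cV[R]_d.+1, [/\ forall k, a' k 0 <= b' k 0,
      f @` box a b `<=` box a' b' & box_volume a' b' = c * box_volume a b]) ->
  scales_volume f c.
Proof.
move=> c0 fbox; apply: scales_volume_box => // a b /fbox[a' [b' [ab' sub <-]]].
by apply: le_trans (lebesgue_rd_le sub) _; exact: lebesgue_rd_box.
Qed.

Lemma scales_volume_translation (R : realType) (d : nat) (v : 'cV[R]_d.+1) :
  scales_volume (fun x => x + v) 1.
Proof.
apply: scales_volume_sub_box => // a b ab; exists (a + v), (b + v); split.
- by move=> k; rewrite !mxE lerD2r.
- by move=> _ [x xab <-] k; rewrite !mxE !lerD2r.
- rewrite mul1r; apply: eq_bigr => k _; rewrite !mxE; lra.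
Qed.

Lemma scales_volume_perm (R : realType) (d : nat) (s : 'S_d.+1) :
  scales_volume (fun x : 'cV[R]_d.+1 => perm_mx s *m x) 1.
Proof.
apply: scales_volume_sub_box => // a b ab.
exists (row_perm s a), (row_perm s b); split.
- by move=> k; rewrite !mxE.
- by move=> _ [x xab <-] k; rewrite -row_permE !mxE.
- rewrite mul1r /box_volume [RHS](reindex_inj (@perm_inj _ s)).
  by apply: eq_bigr => k _; rewrite !mxE.
Qed.

Lemma scales_volume_diag (R : realType) (d : nat) (u : 'rV[R]_d.+1) :
  (forall k, u 0 k != 0) ->
  scales_volume (fun x : 'cV[R]_d.+1 => diag_mx u *m x) (\prod_k `|u 0 k|).
Proof.
move=> u0; apply: scales_volume_sub_box.
  by apply: prodr_gt0 => k _; rewrite normr_gt0.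
move=> a b ab.
exists (\col_k Num.min (u 0 k * a k 0) (u 0 k * b k 0)),
  (\col_k Num.max (u 0 k * a k 0) (u 0 k * b k 0)); split.
- by move=> k; rewrite !mxE ge_min !le_max lexx.
- move=> _ [x xab <-] k; rewrite mul_diag_mx !mxE.
  have /andP[ax xb] := xab k.
  rewrite ge_min le_max; have [uk|/ltW uk] := leP 0 (u 0 k).
    by apply/andP; split; apply/orP; [left|right]; rewrite ler_wpM2l.
  by apply/andP; split; apply/orP; [right|left]; rewrite ler_wnM2l.
- rewrite /box_volume -big_split; apply: eq_bigr => k _ /=; rewrite !mxE.
  have [uk|/ltW uk] := leP 0 (u 0 k).
    by rewrite min_l ?max_r ?ler_wpM2l// ger0_norm// mulrBr.
  by rewrite min_r ?max_l ?(ler_wnM2l uk)// ler0_norm//; ring.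
Qed.

Lemma subinterval_exists (R : realType) (a h x : R) (N : nat) :
  a <= x <= a + N.+1%:R * h ->
  exists m : 'I_N.+1, a + m%:R * h <= x <= a + m.+1%:R * h.
Proof.
elim: N => [|N IH] /andP[ax xb].
  by exists ord0; rewrite mul0r addr0 ax.
have [xN|/ltW Nx] := leP x (a + N.+1%:R * h).
  by have [|m mP] := IH _; [rewrite ax|exists (widen_ord (leqnSn _) m)].
by exists ord_max; rewrite //= Nx.
Qed.

Lemma mul_shear_mx (R : realType) (d : nat) (i j : 'I_d) (c : R)
    (x : 'cV[R]_d) k :
  ((1%:M + c *: delta_mx i j) *m x) k 0 = x k 0 + (c * x j 0) *+ (k == i).
Proof.
rewrite mulmxDl mul1mx !mxE (bigD1 j)//= !mxE eqxx andbT big1 ?addr0.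
  by rewrite -mulr_natr; ring.
by move=> l /negbTE lj; rewrite !mxE lj andbF mulr0 mul0r.
Qed.

(** Cut the box into N + 1 slabs along axis j, of thickness
    h = (b_j - a_j) / (N + 1). On one slab the displacement c x_j along axis i
    varies by at most |c| h, so the sheared slab fits in a box whose side along
    i is longer than that of the original by |c| h. The excess volumes add up to
    the term in 1 / (N + 1). *)
Lemma lebesgue_rd_shear_box (R : realType) (d : nat) (i j : 'I_d.+1) (c : R)
    (a b : 'cV[R]_d.+1) (N : nat) : i != j ->
  (forall k, a k 0 <= b k 0) ->
  (lebesgue_rd ((mulmx (1%:M + c *: delta_mx i j)) @` box a b) <=
   (box_volume a b + `|c| * (b j 0 - a j 0) ^+ 2 *
      (\prod_(k | (k != j) && (k != i)) (b k 0 - a k 0)) / N.+1%:R)%:E)%E.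
Proof.
move=> ij ab; set Q := \prod_(k | _) _.
pose h := (b j 0 - a j 0) / N.+1%:R.
have h0 : 0 <= h by rewrite divr_ge0// subr_ge0.
have hE : N.+1%:R * h = b j 0 - a j 0 by rewrite mulrC divfK// pnatr_eq0.
pose t (m : nat) := a j 0 + m%:R * h.
have tS m : t m.+1 = t m + h by rewrite /t -natr1; ring.
pose lo m : 'cV[R]_d.+1 := \col_k
  if k == j then t m else
  if k == i then a i 0 + Num.min (c * t m) (c * t m.+1) else a k 0.
pose hi m : 'cV[R]_d.+1 := \col_k
  if k == j then t m.+1 else
  if k == i then b i 0 + Num.max (c * t m) (c * t m.+1) else b k 0.
have lohi m k : lo m k 0 <= hi m k 0.
  rewrite !mxE; case: ifP => _; first by rewrite tS; lra.
  case: ifP => [/eqP <-|_] //; rewrite lerD ?ab//.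
  by rewrite ge_min !le_max lexx.
have vol m : box_volume (lo m) (hi m) = h * ((b i 0 - a i 0 + `|c| * h) * Q).
  rewrite /box_volume (bigD1 j)//= (bigD1 i)//= !mxE eqxx (negbTE ij) eqxx.
  congr (_ * (_ * _)); first by rewrite tS; ring.
    rewrite tS; have [c0|/ltW c0] := leP 0 c.
      by rewrite ger0_norm// min_l ?max_r ?mulrDr//; first ring;
        rewrite lerDl mulr_ge0.
    by rewrite ler0_norm// min_r ?max_l ?mulrDr//; first ring;
        rewrite gerDl mulr_le0_ge0.
  by apply: eq_bigr => k /andP[/negbTE kj /negbTE ki]; rewrite !mxE kj ki.
have sub : (mulmx (1%:M + c *: delta_mx i j)) @` box a b `<=`
    \big[setU/set0]_(m < N.+1) box (lo m) (hi m).
  move=> _ [x xab <-]; rewrite -(bigcup_mkord _ (fun m => box (lo m) (hi m))).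
  have [m /andP[tx xt]] : exists m : 'I_N.+1, t m <= x j 0 <= t m.+1.
    by apply: subinterval_exists; rewrite hE addrC subrK xab.
  exists (m : nat); first exact: ltn_ord.
  move=> k; rewrite mul_shear_mx !mxE.
  have [->|kj] := eqVneq k j; first by rewrite eq_sym (negbTE ij) addr0 tx xt.
  have [->|ki] := eqVneq k i; last by rewrite addr0 xab.
  have /andP[ax xb] := xab i.
  rewrite mulr1n; apply/andP; split; apply: lerD => //; rewrite ?ge_min ?le_max.
    have [c0|/ltW c0] := leP 0 c; apply/orP; [left|right].
      by rewrite ler_wpM2l.
    by rewrite ler_wnM2l.
  have [c0|/ltW c0] := leP 0 c; apply/orP; [right|left].
    by rewrite ler_wpM2l.
  by rewrite ler_wnM2l.
apply: le_trans (lebesgue_rd_le sub) _.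
apply: le_trans (lebesgue_rd_bigsetU _ _) _.
apply: (@le_trans _ _ (\sum_(m < N.+1) (box_volume (lo m) (hi m))%:E)%E).
  by apply: lee_sum => m _; apply: lebesgue_rd_box.
rewrite sumEFin lee_fin.
rewrite (eq_bigr (fun=> h * ((b i 0 - a i 0 + `|c| * h) * Q)))//.
rewrite sumr_const card_ord -mulrnAl -mulr_natl hE.
rewrite {1}/box_volume (bigD1 j)//= (bigD1 i)//= -/Q /h le_eqVlt.
apply/orP; left; apply/eqP.
have : N.+1%:R != 0 :> R by rewrite pnatr_eq0.
by move: (N.+1%:R) => z z0; field.
Qed.

Lemma scales_volume_shear (R : realType) (d : nat) (i j : 'I_d.+1) (c : R) :
  i != j -> scales_volume (mulmx (1%:M + c *: delta_mx i j)) 1.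
Proof.
move=> ij; apply: scales_volume_box => // a b ab; rewrite mul1r.
apply/lee_addgt0Pr => e e0.
set K := `|c| * (b j 0 - a j 0) ^+ 2 *
  \prod_(k | (k != j) && (k != i)) (b k 0 - a k 0).
have K0 : 0 <= K.
  by rewrite !mulr_ge0 ?exprn_ge0 ?prodr_ge0// => *; rewrite subr_ge0.
(* K / (N + 1) <= e as soon as N exceeds K / e. *)
have /archi_boundP KN : 0 <= K / e by rewrite divr_ge0// ltW.
apply: le_trans (lebesgue_rd_shear_box c (Num.bound (K / e)) ij ab) _.
rewrite -EFinD lee_fin lerD2l -/K ler_pdivrMr// mulrC -ler_pdivrMr//.
by rewrite -natr1 (le_trans (ltW KN))// lerDl.
Qed.

Lemma scales_volume_mul (R : realType) (d : nat) (M N : 'M[R]_d) (c e : R) :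
  0 <= c -> scales_volume (mulmx M) c -> scales_volume (mulmx N) e ->
  scales_volume (mulmx (M *m N) : 'cV[R]_d -> _) (c * e).
Proof.
move=> c0 Mc Ne X.
have -> : mulmx (M *m N) @` X = (mulmx M \o mulmx N) @` X.
  by congr image; apply/funext => x /=; rewrite mulmxA.
exact: scales_volume_comp.
Qed.

Lemma scales_volume1 (R : realType) (d : nat) :
  scales_volume (mulmx 1%:M : 'cV[R]_d -> _) 1.
Proof.
move=> X; rewrite mul1e; apply: lebesgue_rd_le => _ [x Xx <-].
by rewrite mul1mx.
Qed.

(** Shears that modify rows of the same rank k by means of rows of smaller rank
    multiply by adding up their off-diagonal parts, since the product of two
    such parts vanishes. *)
Lemma scales_volume_shears (R : realType) (d : nat) (M : 'M[R]_d.+1)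
    (r : 'I_d.+1 -> nat) (k : nat) (s : seq ('I_d.+1 * 'I_d.+1)) :
  (forall p, p \in s -> r p.1 = k /\ (r p.2 < k)%N) ->
  scales_volume
    (mulmx (1%:M + \sum_(p <- s) M p.1 p.2 *: delta_mx p.1 p.2)) 1.
Proof.
elim: s => [_|p s IH sk]; first by rewrite big_nil addr0; exact: scales_volume1.
have [p1 p2] := sk p (mem_head _ _).
have pne : p.1 != p.2 by apply: contraTneq p2 => <-; rewrite p1 ltnn.
have := scales_volume_mul ler01 (scales_volume_shear (M p.1 p.2) pne)
  (IH (fun q qs => sk q (mem_behead (s := p :: s) qs))).
have N2 : M p.1 p.2 *: delta_mx p.1 p.2 *m
    (\sum_(q <- s) M q.1 q.2 *: delta_mx q.1 q.2) = 0.
  rewrite mulmx_sumr big1_seq// => q /= qs.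
  have [q1 _] := sk q (mem_behead (s := p :: s) qs).
  rewrite -scalemxAl -scalemxAr mul_delta_mx_0 ?scaler0//.
  by apply: contraTneq p2 => ->; rewrite q1 ltnn.
by rewrite mulr1 mulmxDr mulmx1 mulmxDl mul1mx N2 addr0 big_cons addrA.
Qed.

(** The rank function r lets one statement cover lower triangular matrices
    (r = identity) and upper triangular ones (r reversing the order). The rows
    of M are put in place by decreasing rank: [tail k] has those of rank at
    least k, and passing from [tail k.+1] to [tail k] is a left multiplication
    by shears. *)
Lemma scales_volume_unitriangular (R : realType) (d : nat) (M : 'M[R]_d.+1)
    (r : 'I_d.+1 -> nat) :
  (forall i, M i i = 1) ->
  (forall i j, i != j -> M i j != 0 -> (r j < r i)%N) ->
  scales_volume (mulmx M) 1.
Proof.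
move=> M1 Mr.
pose tail k : 'M[R]_d.+1 := \matrix_(i, j)
  if (k <= r i)%N then M i j else (i == j)%:R.
pose N := (\max_i r i).+1.
suff H : forall m, scales_volume (mulmx (tail (N - m)%N)) 1.
  have -> : M = tail (N - N)%N by apply/matrixP => i j; rewrite mxE subnn.
  exact: H.
elim=> [|m IH].
  have -> : tail (N - 0)%N = 1%:M; last exact: scales_volume1.
  apply/matrixP => i j; rewrite !mxE subn0 leqNgt ltnS leq_bigmax//=.
have [Nm|mN] := leqP N m.
  by have -> : (N - m.+1 = N - m)%N by lia.
set k := (N - m.+1)%N; have kS : (N - m = k.+1)%N by rewrite /k; lia.
pose s := [seq p <- enum {: 'I_d.+1 * 'I_d.+1} | (r p.1 == k) && (r p.2 < k)%N].
have sP p : p \in s -> r p.1 = k /\ (r p.2 < k)%N.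
  by rewrite mem_filter => /andP[/andP[/eqP]].
have := scales_volume_mul ler01 (scales_volume_shears M sP) IH.
rewrite mulr1 kS; congr (scales_volume (mulmx _) _).
apply/matrixP => i j.
have sE l : (\sum_(p <- s) M p.1 p.2 *: delta_mx p.1 p.2) i l =
    if (r i == k) && (r l < k)%N then M i l else 0.
  rewrite summxE big_filter big_enum_cond /= big_mkcond (bigD1 (i, l))//=.
  rewrite !mxE !eqxx mulr1 big1 ?addr0// => -[i' l'] /negbTE il.
  by rewrite !mxE [i == _]eq_sym [l == _]eq_sym -xpair_eqE il mulr0 if_same.
rewrite mulmxDl mul1mx !mxE (eq_bigr (fun l =>
    (if (r i == k) && (r l < k)%N then M i l else 0) * (l == j)%:R)).
  rewrite (bigD1 j)//= big1 ?addr0 => [|l /negbTE ->]; last by rewrite mulr0.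
  rewrite eqxx mulr1.
  have [ik|ik] := eqVneq (r i) k; last by rewrite addr0 ltn_neqAle eq_sym ik.
  rewrite ik ltnn leqnn /=.
  have [<-|ij] := eqVneq i j; first by rewrite ik ltnn addr0 M1.
  rewrite add0r; case: ifPn => // rjk; apply/esym/eqP.
  by apply: contraNT rjk => /(Mr _ _ ij); rewrite ik.
move=> l _; rewrite sE !mxE.
case: ifP => [/andP[_ lk]|_]; last by rewrite !mul0r.
by rewrite ltnNge ltnW.
Qed.

(** With s B = L U as in the LUP decomposition and D the diagonal of U, B is the
    product of a permutation, the unitriangular L, D, and the unitriangular
    D^-1 U; only D contributes to |det B|. *)
Lemma scales_volume_mulmx (R : realType) (d : nat) (B : 'M[R]_d.+1) :
  \det B != 0 -> scales_volume (mulmx B) `|\det B|.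
Proof.
move=> B0.
have [s [L [U [BE detL Llow Uup]]]] : exists (s : 'S_d.+1) (L U : 'M[R]_d.+1),
    [/\ perm_mx s *m B = L *m U, \det L = 1,
       forall i j : 'I_d.+1, (i <= j)%N -> L i j = (i == j)%:R
     & forall i j : 'I_d.+1, (j < i)%N -> U i j = 0].
  have := cormen_lup_correct B; have := cormen_lup_perm B.
  have := cormen_lup_detL B; have := @cormen_lup_lower _ _ B.
  have := @cormen_lup_upper _ _ B.
  case: (cormen_lup B) => [[P L] U] /= Uup Llow detL /is_perm_mxP[s ->] BE.
  by exists s, L, U.
have detU : `|\det B| = \prod_k `|U k k|.
  have -> : \det B = (-1) ^+ s * \det U.
    have := congr1 determinant BE; rewrite !det_mulmx detL mul1r det_perm => <-.
    by rewrite mulrA -expr2 sqrr_sign mul1r.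
  rewrite normrM normr_sign mul1r.
  rewrite -det_tr det_trig ?normr_prod => [|].
    by apply: eq_bigr => k _; rewrite mxE.
  by apply/is_trig_mxP => i j ij; rewrite mxE Uup.
have U0 k : U k k != 0.
  move: B0; rewrite -normr_eq0 detU => /prodf_neq0/(_ k isT).
  by rewrite normr_eq0.
pose D : 'rV[R]_d.+1 := \row_k U k k.
(* U = D V with V unitriangular. *)
pose V : 'M[R]_d.+1 := \matrix_(i, j) ((U i i)^-1 * U i j).
have UE : U = diag_mx D *m V.
  by apply/matrixP => i j; rewrite mul_diag_mx !mxE mulVKf.
have -> : `|\det B| = 1 * (1 * ((\prod_k `|D 0 k|) * 1)).
  by rewrite !mul1r mulr1 detU; apply: eq_bigr => k _; rewrite mxE.
have -> : B = perm_mx s^-1 *m (L *m (diag_mx D *m V)).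
  by rewrite -UE -[L *m U]BE mulmxA -perm_mxM mulVg perm_mx1 mul1mx.
apply: scales_volume_mul => //; first exact: scales_volume_perm.
apply: scales_volume_mul => //.
  apply: (@scales_volume_unitriangular _ _ _ (@nat_of_ord _)).
    by move=> i; rewrite Llow ?eqxx.
  move=> i j ij; rewrite ltnNge; apply: contraNN => /Llow ->.
  by rewrite (negbTE ij).
apply: scales_volume_mul; first exact: prodr_ge0.
  by apply: scales_volume_diag => k; rewrite mxE.
apply: (@scales_volume_unitriangular _ _ _ (fun i => d - i)%N).
  by move=> i; rewrite mxE mulVf.
move=> i j ij; rewrite mxE => V0.
have : (i <= j)%N.
  by rewrite leqNgt; apply: contraNN V0 => /Uup ->; rewrite mulr0.
rewrite leq_eqVlt => /orP[/eqP/val_inj/eqP|]; first by rewrite (negbTE ij).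
by have := ltn_ord j; lia.
Qed.

Lemma lebesgue_rd_mulmx_ge (R : realType) (d : nat) (B : 'M[R]_d.+1) X :
  (`|\det B|%:E * lebesgue_rd X <= lebesgue_rd (mulmx B @` X))%E.
Proof.
have [->|B0] := eqVneq (\det B) 0.
  by rewrite normr0 mul0e lebesgue_rd_ge0.
have Bu : B \in unitmx by rewrite unitmxE unitfE.
have BV : \det (invmx B) != 0 by rewrite det_inv invr_eq0.
have := scales_volume_mulmx BV (mulmx B @` X).
have -> : mulmx (invmx B) @` (mulmx B @` X) = X.
  rewrite image_comp (_ : _ \o _ = id) ?image_id//.
  by apply/funext => x /=; rewrite mulKmx.
by rewrite det_inv normfV lee_pdivlMl ?normr_gt0.
Qed.

(** The norm on columns is the maximum norm, so a bounded set lies in a cube. *)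
Lemma compact_lebesgue_rd_fin (R : realType) (d : nat) (X : set 'cV[R]_d.+1) :
  compact X -> (lebesgue_rd X < +oo)%E.
Proof.
move=> /compact_bounded [M [Mr XM]].
have M1 : M < `|M| + 1 by rewrite (le_lt_trans (ler_norm M))// ltrDl.
pose b : 'cV[R]_d.+1 := const_mx (`|M| + 1).
have Xb : X `<=` box (- b) b.
  move=> x /(XM _ M1) xM k; rewrite !mxE -ler_norml.
  apply: le_trans xM; rewrite [leRHS]/Num.norm /= mx_normrE.
  by apply/bigmax_geP; right; exists (k, 0).
apply: le_lt_trans (lebesgue_rd_le Xb) _.
apply: le_lt_trans (lebesgue_rd_box _) (ltry _) => k.
by rewrite !mxE; have := normr_ge0 M; lra.
Qed.

(** * Volumes of the tiles *)

Lemma lebesgue_rd_set_translates (R : realType) (d : nat) (X : set 'cV[R]_d.+1)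
    (E : {fset 'cV[R]_d.+1}) :
  (lebesgue_rd (set_translates X E) <= (#|` E|%:R)%:E * lebesgue_rd X)%E.
Proof.
apply: (@le_trans _ _ (\sum_(e <- E) lebesgue_rd X)%E); last first.
  by rewrite mule_natl big_const_seq count_predT iter_addr_0.
apply: (@le_trans _ _
  (\sum_(e <- E) lebesgue_rd ((fun x => (x + e)%R) @` X))%E).
  apply: le_trans (lebesgue_rd_bigsetU _ _); apply: lebesgue_rd_le.
  move=> _ [t Xt [e Ee <-]]; rewrite -bigcup_seq; exists e => //; by exists t.
apply: lee_sum => e _.
by have := scales_volume_translation e X; rewrite mul1e.
Qed.

Lemma multi_tile_volume_le (R : realType) (d n : nat) (A : 'M[R]_d.+1)
  (D : 'I_n -> 'I_n -> {fset 'cV[R]_d.+1}) (T : 'I_n -> set 'cV[R]_d.+1) i :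
  multi_tile_equation A D T ->
  (`|\det A|%:E * lebesgue_rd (T i) <=
   \sum_j (subdivision_mx D j i)%:E * lebesgue_rd (T j))%E.
Proof.
move=> /(_ i) AT; apply: le_trans (lebesgue_rd_mulmx_ge _ _) _; rewrite AT.
apply: (@le_trans _ _ (\sum_j lebesgue_rd (set_translates (T j) (D j i)))%E).
  apply: le_trans (lebesgue_rd_bigsetU _ _); apply: lebesgue_rd_le.
  move=> x [j _ xj]; rewrite -(bigcup_seq (index_enum _)); exists j => //=.
  by rewrite mem_index_enum.
by apply: lee_sum => j _; rewrite mxE lebesgue_rd_set_translates.
Qed.

(** * Positive eigenvectors of primitive matrices *)

Lemma mulmx_row_gt0 (R : realType) (n : nat) (P : 'M[R]_n) (x : 'rV[R]_n) :
  (forall i j, 0 < P i j) -> (forall i, 0 <= x 0 i) -> x != 0 ->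
  forall j, 0 < (x *m P) 0 j.
Proof.
move=> P0 x0 xn0 j; rewrite !mxE.
have [i xi] : exists i, x 0 i != 0.
  apply/existsP; apply: contraNT xn0; rewrite negb_exists => /forallP H.
  by apply/eqP/rowP => i; rewrite mxE; apply/eqP; have := H i; rewrite negbK.
rewrite (bigD1 i)//= ltr_pwDl//; first by rewrite mulr_gt0// lt0r xi x0.
by apply: sumr_ge0 => k _; rewrite mulr_ge0// ltW.
Qed.

Lemma eigenvector_expmx (R : comNzRingType) (n : nat) (M : 'M[R]_n) (k : nat)
    (l : R) (x : 'rV[R]_n) :
  x *m M = l *: x -> x *m (M ^+ k) = l ^+ k *: x.
Proof.
move=> xM; elim: k => [|k IH]; first by rewrite !expr0 mulmx1 scale1r.
by rewrite !exprS mulmxA xM -scalemxAl IH scalerA.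
Qed.

(** The largest t that has a partner x in the simplex is the Collatz-Wielandt
    characterization of the Perron eigenvalue. *)
Definition subinvariant (R : realType) (n : nat) (M : 'M[R]_n) :
    set (R * 'rV[R]_n) :=
  [set q : R * 'rV[R]_n | forall j, q.1 * q.2 0 j <= (q.2 *m M) 0 j].

Definition simplex (R : realType) (n : nat) : set 'rV[R]_n :=
  [set x : 'rV[R]_n | (forall i, 0 <= x 0 i) /\ \sum_i x 0 i = 1].

Lemma closed_leq_fun (R : realType) (X : topologicalType) (f g : X -> R) :
  continuous f -> continuous g -> closed [set x | f x <= g x].
Proof.
move=> cf cg.
have -> : [set x | f x <= g x] = (fun x => f x - g x) @^-1` [set y | y <= 0].
  by apply/seteqP; split => x /=; rewrite subr_le0.
apply: preimage_closed; last exact: closed_le.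
by move=> x _; apply: cvgB; [exact: cf|exact: cg].
Qed.

Lemma continuous_sum_fun (R : realType) (X : topologicalType) (I : Type)
    (s : seq I) (f : I -> X -> R) :
  (forall i, continuous (f i)) -> continuous (fun x => \sum_(i <- s) f i x).
Proof.
move=> cf; elim: s => [|i s IH] x.
  rewrite (_ : (fun _ => _) = cst 0); first exact: cst_continuous.
  by apply/funext => y; rewrite big_nil.
rewrite (_ : (fun _ => _) = f i \+ (fun y => \sum_(j <- s) f j y)).
  by apply: cvgD; [exact: cf|exact: IH].
by apply/funext => y; rewrite big_cons.
Qed.

Lemma simplex_compact (R : realType) (n : nat) : compact (@simplex R n).
Proof.
apply: bounded_closed_compact.
  exists 1; split; first exact: real1.
  move=> M M1 x [x0 x1]; rewrite /globally /= [leLHS]/Num.norm /= mx_normrE.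
  apply/bigmax_leP; split; first by rewrite ltW// (lt_trans ltr01).
  move=> [i j] _ /=; rewrite ord1 ger0_norm//; apply: le_trans (ltW M1).
  by rewrite -x1 (bigD1 j)//= lerDl sumr_ge0.
have -> : @simplex R n =
    (\bigcap_(i in [set: 'I_n]) [set x : 'rV[R]_n | 0 <= x 0 i]) `&`
    ((fun x : 'rV[R]_n => \sum_i x 0 i) @^-1` [set y | y = 1]).
  by apply/seteqP; split => x /= [x0 x1]; split => // i *; exact: x0.
apply: closedI.
  apply: closed_bigI => i _.
  by apply: closed_leq_fun; [exact: cst_continuous|exact: coord_continuous].
apply: preimage_closed; last exact: closed_eq.
by move=> x _; apply: continuous_sum_fun => i; exact: coord_continuous.
Qed.

Lemma subinvariant_closed (R : realType) (n : nat) (M : 'M[R]_n) :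
  closed (subinvariant M).
Proof.
have -> : subinvariant M = \bigcap_(j in [set: 'I_n])
    [set q : R * 'rV[R]_n | q.1 * q.2 0 j <= \sum_i q.2 0 i * M i j].
  apply/seteqP; split => q qM j; first by have := qM j; rewrite mxE.
  by rewrite mxE; exact: qM.
apply: closed_bigI => j _; apply: closed_leq_fun => q.
  apply: cvgM; first exact: cvg_fst.
  apply: (@continuous_comp _ _ _ snd (fun x : 'rV[R]_n => x 0 j)).
    exact: cvg_snd.
  exact: coord_continuous.
apply: continuous_sum_fun => i {}q; apply: cvgM; last exact: cvg_cst.
apply: (@continuous_comp _ _ _ snd (fun x : 'rV[R]_n => x 0 i)).
  exact: cvg_snd.
exact: coord_continuous.
Qed.

Lemma subinvariant_bounded (R : realType) (n : nat) (M : 'M[R]_n) t x :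
  (forall i j, 0 <= M i j) -> simplex x -> subinvariant M (t, x) ->
  t <= \sum_i \sum_j M i j.
Proof.
move=> M0 [x0 x1] tx; rewrite -[t]mulr1 -x1 mulr_sumr.
apply: (@le_trans _ _ (\sum_j (x *m M) 0 j)).
  by apply: ler_sum => j _; exact: tx.
under eq_bigr do rewrite mxE.
rewrite exchange_big /=; apply: ler_sum => i _; apply: ler_sum => j _.
rewrite -[leRHS]mul1r ler_wpM2r// -x1 (bigD1 i)//= lerDl.
by apply: sumr_ge0.
Qed.

(** The relevant pairs form a compact set, because t cannot exceed the sum of
    the entries of M. *)
Lemma subinvariant_max (R : realType) (n : nat) (M : 'M[R]_n) : (0 < n)%N ->
  (forall i j, 0 <= M i j) ->
  exists l x, [/\ 0 <= l, simplex x, subinvariant M (l, x)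
    & forall t y, simplex y -> subinvariant M (t, y) -> t <= l].
Proof.
case: n M => // n M _ M0; pose C := \sum_i \sum_j M i j.
pose x0 : 'rV[R]_n.+1 := delta_mx 0 0.
have sx0 : simplex x0.
  split=> [i|]; first by rewrite mxE ler0n.
  rewrite (bigD1 0)//= mxE !eqxx big1 ?addr0// => i /negbTE i0.
  by rewrite mxE i0 andbF.
have ix0 : subinvariant M (0, x0).
  move=> j /=; rewrite mul0r mxE; apply: sumr_ge0 => i _.
  by rewrite mulr_ge0// mxE ler0n.
pose K := (`[0, C] `*` @simplex R n.+1) `&` subinvariant M.
have K0 : K (0, x0).
  split=> //; split=> //=; rewrite in_itv /= lexx.
  exact: subinvariant_bounded ix0.
have cK : compact K.
  apply: compact_closedI; last exact: subinvariant_closed.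
  by apply: compact_setX; [exact: segment_compact|exact: simplex_compact].
have [||[l x] /set_mem [[lC sx] ix] lmax] := compact_EVT_max _ cK
  (f := fst : R * 'rV[R]_n.+1 -> R).
- by exists (0, x0).
- by apply: continuous_subspaceT => q; exact: cvg_fst.
exists l, x; split=> //; first by move: lC; rewrite /= in_itv /= => /andP[].
move=> t y sy iy; have [t0|/ltW t0] := leP 0 t.
  apply: (lmax (t, y)); apply/mem_set; split=> //; split=> //=.
  by rewrite in_itv /= t0; exact: subinvariant_bounded iy.
by apply: le_trans t0 _; move: lC; rewrite /= in_itv /= => /andP[].
Qed.

Lemma simplex_neq0 (R : realType) (n : nat) (x : 'rV[R]_n) :
  simplex x -> x != 0.
Proof.
move=> [_ x1]; apply: contra_eq_neq x1 => ->; rewrite big1 1?eq_sym ?oner_eq0//.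
by move=> i _; rewrite mxE.
Qed.

Lemma simplex_normalize (R : realType) (n : nat) (x : 'rV[R]_n) : (0 < n)%N ->
  (forall i, 0 < x 0 i) -> simplex ((\sum_i x 0 i)^-1 *: x).
Proof.
case: n x => // n x _ x0.
have s0 : 0 < \sum_i x 0 i.
  by rewrite big_ord_recl ltr_pwDl// sumr_ge0// => i _; rewrite ltW.
split=> [i|]; first by rewrite mxE mulr_ge0 ?invr_ge0 ?ltW.
under eq_bigr do rewrite mxE.
by rewrite -mulr_sumr mulVf// gt_eqF.
Qed.

(** At a maximal pair (l, x), if x M - l x were nonzero, then multiplying it by
    the positive power M^k would make every entry positive, so that w = x M^k
    satisfies l w < w M strictly and l could be increased. *)
Lemma positive_left_eigenvector (R : realType) (n : nat) (M : 'M[R]_n) :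
  (0 < n)%N -> primitive_mx M ->
  exists l (p : 'rV[R]_n), [/\ 0 < l, forall i, 0 < p 0 i & p *m M = l *: p].
Proof.
case: n M => // n M _ [M0 [k k0 Mk]].
have [l [x [l0 sx ix lmax]]] := subinvariant_max (ltn0Sn n) M0.
have [x0 _] := sx; have xn0 := simplex_neq0 sx.
have xM : x *m M = l *: x.
  apply/eqP; rewrite -subr_eq0; apply: contraT => zn0; exfalso.
  have zM : forall j, 0 < ((x *m M - l *: x) *m M ^+ k) 0 j.
    apply: mulmx_row_gt0 => // i; rewrite !mxE subr_ge0.
    by have := ix i; rewrite mxE.
  pose w := x *m M ^+ k; have w0 : forall i, 0 < w 0 i by apply: mulmx_row_gt0.
  have wM j : l * w 0 j < (w *m M) 0 j.
    have := zM j; rewrite mulmxBl -mulmxA -scalemxAl.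
    have -> : M *m M ^+ k = M ^+ k *m M by rewrite -[LHS]exprS -[RHS]exprSr.
    by rewrite mulmxA -/w !mxE subr_gt0.
  (* The largest t such that t w <= w M is the minimal ratio. *)
  pose e := [arg min_(i < (ord0 : 'I_n.+1)) ((w *m M) 0 i / w 0 i)]%O.
  pose t := (w *m M) 0 e / w 0 e.
  have tmin j : t <= (w *m M) 0 j / w 0 j.
    by rewrite /t /e; case: arg_minP => // i _; apply.
  have lt : l < t by rewrite ltr_pdivlMr.
  have sw := simplex_normalize (ltn0Sn n) w0.
  have : t <= l.
    apply: lmax sw _ => j /=; rewrite -scalemxAl mxE [leRHS]mxE mulrCA.
    have s0 : 0 <= (\sum_i w 0 i)^-1.
      by rewrite invr_ge0 sumr_ge0// => i _; rewrite ltW.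
    by rewrite ler_wpM2l// -ler_pdivlMr.
  by rewrite leNgt lt.
have xk : forall j, 0 < (x *m M ^+ k) 0 j by apply: mulmx_row_gt0.
have xpos j : 0 < x 0 j.
  rewrite lt0r x0 andbT; apply: contraTneq (xk j) => xj.
  by rewrite (eigenvector_expmx k xM) mxE xj mulr0 ltxx.
exists l, x; split=> //.
rewrite lt0r l0 andbT; apply: contraTneq (xk ord0) => l00.
by rewrite (eigenvector_expmx k xM) mxE l00 expr0n gtn_eqF// mul0r ltxx.
Qed.

Lemma primitive_mx_tr (R : realType) (n : nat) (M : 'M[R]_n) :
  primitive_mx M -> primitive_mx M^T.
Proof.
move=> [M0 [k k0 Mk]]; split=> [i j|]; first by rewrite mxE.
exists k => // i j.
have -> : M^T ^+ k = (M ^+ k)^T; last by rewrite mxE.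
elim: k {k0 Mk} => [|k IH]; first by rewrite !expr0 trmx1.
by rewrite exprS exprSr IH trmx_mul.
Qed.

(** Subtract from x the largest multiple of p that leaves it nonnegative. The
    difference is an eigenvector with a zero entry, whereas M^k would turn a
    nonzero one into a positive vector. *)
Lemma perron_eigenspace (R : realType) (n : nat) (M : 'M[R]_n) (l : R)
    (p x : 'rV[R]_n) :
  (0 < n)%N -> primitive_mx M -> (forall i, 0 < p 0 i) ->
  p *m M = l *: p -> x *m M = l *: x -> exists c, x = c *: p.
Proof.
case: n M p x => // n M p x _ [M0 [k k0 Mk]] p0 pM xM.
pose e := [arg min_(i < (ord0 : 'I_n.+1)) (x 0 i / p 0 i)]%O.
pose c := x 0 e / p 0 e; exists c.
have cmin j : c <= x 0 j / p 0 j.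
  by rewrite /c /e; case: arg_minP => // i _; apply.
apply/eqP; rewrite -subr_eq0; apply: contraT => zn0; exfalso.
have zM : (x - c *: p) *m M = l *: (x - c *: p).
  by rewrite mulmxBl xM -scalemxAl pM scalerBr !scalerA mulrC.
have : 0 < ((x - c *: p) *m M ^+ k) 0 e.
  apply: mulmx_row_gt0 => // i.
  by rewrite !mxE subr_ge0 -ler_pdivlMr.
rewrite (eigenvector_expmx k zM) !mxE /c divfK ?gt_eqF//.
by rewrite subrr mulr0 ltxx.
Qed.

Lemma row_mul_col_gt0 (R : realType) (n : nat) (p : 'rV[R]_n) (u : 'cV[R]_n) :
  (0 < n)%N -> (forall i, 0 < p 0 i) -> (forall i, 0 < u i 0) ->
  0 < (p *m u) 0 0.
Proof.
case: n p u => // n p u _ p0 u0; rewrite mxE big_ord_recl ltr_pwDl ?mulr_gt0//.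
by apply: sumr_ge0 => i _; rewrite mulr_ge0 ?ltW.
Qed.

(** Let x (M - u p) = l x. Multiplying by u on the right gives (x u) (p u) = 0,
    hence x u = 0 and x is an eigenvector of M for l, that is, x = c p; but then
    x u = c (p u), so c = 0. *)
Lemma perron_deflation_Neigenvalue (R : realType) (n : nat) (M : 'M[R]_n) l
    (p : 'rV[R]_n) (u : 'cV[R]_n) :
  (0 < n)%N -> primitive_mx M ->
  (forall i, 0 < p 0 i) -> (forall i, 0 < u i 0) ->
  p *m M = l *: p -> M *m u = l *: u -> ~~ eigenvalue (M - u *m p) l.
Proof.
move=> n0 prM p0 u0 pM Mu; apply/negP => /eigenvalueP[x xM xn0].
have pu := row_mul_col_gt0 n0 p0 u0.
have xM' : x *m M = l *: x + (x *m u) *m p.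
  by rewrite -xM mulmxBr mulmxA subrK.
have : (x *m u) 0 0 * (p *m u) 0 0 = 0.
  have E : x *m M *m u = (l *: x + (x *m u) *m p) *m u by rewrite xM'.
  move: E; rewrite -[x *m M *m u]mulmxA Mu mulmxDl -scalemxAl -scalemxAr.
  rewrite -[_ *m p *m u]mulmxA -[LHS]addr0 => /addrI/matrixP/(_ 0 0).
  by rewrite [RHS]mxE big_ord1 mxE.
move/eqP; rewrite mulf_eq0 (gt_eqF pu) orbF => /eqP xu.
have xu0 : x *m u = 0 by apply/matrixP => i j; rewrite !ord1 xu mxE.
move: xM'; rewrite xu0 mul0mx addr0 => {}xM.
have [c xc] := perron_eigenspace n0 prM p0 pM xM.
move: xu; rewrite xc -scalemxAl mxE => /eqP.
rewrite mulf_eq0 (gt_eqF pu) orbF => /eqP c0.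
by move: xn0; rewrite xc c0 scale0r eqxx.
Qed.

(** * Simplicity of the Perron eigenvalue *)

(** Sylvester's determinant identity: the block matrix with rows (1, -p) and
    (u, c) is reduced once by row operations and once by column operations. *)
Lemma det_scalar_add_rank1 (R : comNzRingType) (n : nat) (c : R)
    (u : 'cV[R]_n) (p : 'rV[R]_n) :
  c * \det (c%:M + u *m p) = (c + (p *m u) 0 0) * c ^+ n.
Proof.
pose B := block_mx (1%:M : 'M[R]_1) (- p) u c%:M.
have BE : \det B = \det (c%:M + u *m p).
  have -> : \det (c%:M + u *m p) = \det (block_mx (1%:M : 'M[R]_1) 0 u 1%:M) *
      \det (block_mx (1%:M : 'M[R]_1) (- p) 0 (c%:M + u *m p)).
    by rewrite det_lblock det_ublock !det1 !mul1r.
  rewrite -det_mulmx mulmx_block !mul1mx !mul0mx !addr0 mulmx1 mulmxN.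
  by rewrite addrCA addNr addr0.
have : \det (B *m block_mx (c%:M : 'M[R]_1) 0 (- u) 1%:M) = \det B * c.
  by rewrite det_mulmx det_lblock det1 mulr1 det_scalar1.
rewrite mulmx_block !mul1mx !mulmx1 !mulmx0 !add0r mulNmx mulmxN opprK.
rewrite mulmxN mul_scalar_mx mul_mx_scalar subrr det_ublock det_scalar BE => E.
rewrite mulrC -E.
by rewrite det_mx11 !mxE eqxx.
Qed.

(** Brauer's theorem. Since (X - M) u = (X - l) u, one has
    (X - M) ((X - l) + u p) = (X - l) (X - M + u p); take determinants. *)
Lemma char_poly_deflation (R : idomainType) (n : nat) (M : 'M[R]_n) l
    (p : 'rV[R]_n) (u : 'cV[R]_n) :
  M *m u = l *: u ->
  char_poly M * ('X - l%:P + ((p *m u) 0 0)%:P) =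
  ('X - l%:P) * char_poly (M - u *m p).
Proof.
move=> Mu; pose c : {poly R} := 'X - l%:P.
have c0 : c != 0 by rewrite polyXsubC_eq0.
pose P := map_mx (@polyC R) p; pose U := map_mx (@polyC R) u.
have PU : (P *m U) 0 0 = ((p *m u) 0 0)%:P by rewrite -map_mxM mxE.
have MU : char_poly_mx M *m U = c *: U.
  by rewrite mulmxBl -map_mxM Mu map_mxZ mul_scalar_mx -scalerBl.
have E : char_poly_mx M *m (c%:M + U *m P) = c *: char_poly_mx (M - u *m p).
  rewrite mulmxDr mulmxA MU -scalemxAl mul_mx_scalar -scalerDr.
  by rewrite /char_poly_mx map_mxB map_mxM opprB addrA addrAC.
have := congr1 (fun N => c * \det N) E.
rewrite det_mulmx detZ mulrCA det_scalar_add_rank1 PU => {}E.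
apply: (mulfI (expf_neq0 n c0)).
by rewrite [LHS]mulrC -mulrA E mulrCA.
Qed.

(** In the identity of [char_poly_deflation] the factor X - l + p u and the
    characteristic polynomial of M - u p do not vanish at l. *)
Lemma perron_simple (R : realType) (n : nat) (M : 'M[R]_n) l
    (p : 'rV[R]_n) (u : 'cV[R]_n) :
  (0 < n)%N -> primitive_mx M ->
  (forall i, 0 < p 0 i) -> (forall i, 0 < u i 0) ->
  p *m M = l *: p -> M *m u = l *: u -> mup l (char_poly M) = 1%N.
Proof.
move=> n0 prM p0 u0 pM Mu; have pu := row_mul_col_gt0 n0 p0 u0.
have := perron_deflation_Neigenvalue n0 prM p0 u0 pM Mu.
rewrite eigenvalue_root_char => Nroot.
have := congr1 (mup l) (char_poly_deflation p Mu).
rewrite mupMl; last by rewrite rootE !hornerE subrr add0r gt_eqF.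
by rewrite mupMl// (@mup_XsubCX _ 1) eqxx.
Qed.

(** * The spectral radius *)

(** For v M = z v the vector |v| satisfies |z| |v| <= |v| M; pair with u. *)
Lemma perron_eigenvalue_max (R : realType) (n : nat) (M : 'M[R]_n) l
    (u : 'cV[R]_n) (z : R[i]) :
  (forall i j, 0 <= M i j) -> (forall i, 0 < u i 0) ->
  M *m u = l *: u -> complex_eigenvalue M z -> complex.Re `|z| <= l.
Proof.
move=> M0 u0 Mu /eigenvalueP[v vM vn0].
pose a i : R := complex.Re `|v 0 i|.
have aE i : `|v 0 i| = (a i)%:C%C by rewrite /a normc_def.
pose t : R := complex.Re `|z|.
have tE : `|z| = t%:C%C by rewrite /t normc_def.
have sub j : t * a j <= \sum_i a i * M i j.
  rewrite -(@lecR R) !rmorphM /= -tE -aE -normrM rmorph_sum /=.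
  have /(congr1 (fun w : 'rV[R[i]]_n => w 0 j)) := vM.
  rewrite mxE [RHS]mxE => <-.
  apply: le_trans (ler_norm_sum _ _ _) _; apply: ler_sum => i _.
  have MC : `|(M i j)%:C%C| = (M i j)%:C%C by rewrite ger0_norm// (@lecR R 0).
  by rewrite normrM rmorphM /= -aE mxE MC.
have a0 i : 0 <= a i by rewrite -(@lecR R 0) -aE normr_ge0.
have [i vi] : exists i, v 0 i != 0.
  apply/existsP; apply: contraNT vn0; rewrite negb_exists => /forallP H.
  by apply/eqP/rowP => i; rewrite mxE; apply/eqP; have := H i; rewrite negbK.
have s0 : 0 < \sum_j a j * u j 0.
  rewrite (bigD1 i)//= ltr_pwDl//.
    by rewrite mulr_gt0// -(@ltcR R 0) -aE normr_gt0.
  by apply: sumr_ge0 => j _; rewrite mulr_ge0// ltW.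
rewrite -(ler_pM2r s0) !mulr_sumr.
apply: (@le_trans _ _ (\sum_j (\sum_i a i * M i j) * u j 0)).
  by apply: ler_sum => j _; rewrite mulrA ler_wpM2r// ltW.
under eq_bigr do rewrite mulr_suml.
rewrite exchange_big /=; apply: ler_sum => k _.
have /(congr1 (fun w : 'cV[R]_n => w k 0)) := Mu; rewrite !mxE => Muk.
rewrite mulrCA -Muk mulr_sumr; apply: ler_sum => j _; by rewrite mulrA.
Qed.

(** The left and right positive eigenvectors belong to the same eigenvalue, as
    p M u is computed in two ways and p u is not zero. *)
Lemma primitive_perron (R : realType) (n : nat) (M : 'M[R]_n) :
  (0 < n)%N -> primitive_mx M ->
  exists l (u : 'cV[R]_n), [/\ is_perron_eigenvalue M l, forall i, 0 < u i 0
    & M *m u = l *: u].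
Proof.
move=> n0 prM.
have [l [p [l0 p0 pM]]] := positive_left_eigenvector n0 prM.
have [l' [q [_ q0 qM]]] := positive_left_eigenvector n0 (primitive_mx_tr prM).
pose u := q^T; have u0 i : 0 < u i 0 by rewrite mxE.
have Mu' : M *m u = l' *: u.
  by apply: trmx_inj; rewrite trmx_mul trmxK qM linearZ /= trmxK.
have pu := row_mul_col_gt0 n0 p0 u0.
have ll' : l' = l.
  have : (p *m M) *m u = p *m (M *m u) by rewrite mulmxA.
  rewrite pM Mu' -scalemxAl -scalemxAr => /matrixP/(_ 0 0).
  by rewrite mxE [RHS]mxE => /(mulIf (lt0r_neq0 pu)).
have Mu : M *m u = l *: u by rewrite -ll'.
exists l, u; split=> //.
have el : eigenvalue M l.
  apply/eigenvalueP; exists p => //; apply: contraTneq pu => ->.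
  by rewrite mul0mx mxE ltxx.
have cl : complex_eigenvalue M l%:C%C.
  rewrite /complex_eigenvalue eigenvalue_root_char -map_char_poly.
  by rewrite rmorph_root// -eigenvalue_root_char.
split=> //; first exact: perron_simple prM p0 u0 pM Mu.
pose E := [set complex.Re `|z| | z in [set z | complex_eigenvalue M z]].
have lE : E l.
  exists l%:C%C; first exact: cl.
  by rewrite ger0_norm// (@lecR R 0) ltW.
have ubl : ubound E l.
  by case: prM => M0 _ _ [z zM <-]; exact: perron_eigenvalue_max M0 u0 Mu zM.
apply/eqP; rewrite eq_le ge_sup//; last by exists l.
by rewrite andbT; apply: ub_le_sup => //; exists l.
Qed.

(** Two Perron eigenvalues of M are both equal to its spectral radius. *)
Lemma perron_eigenvalueE (R : realType) (n : nat) (M : 'M[R]_n) l :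
  is_perron_eigenvalue M l -> perron_eigenvalue M = l.
Proof.
move=> Ml; rewrite /perron_eigenvalue; case: xgetP => [y _ [_ _ _ ->]|/(_ l)//].
by case: Ml.
Qed.

(** * Comparing the determinant with the Perron eigenvalue *)

Theorem theorem5p2 (R : realType) (d n : nat) (hd : (0 < d)%N) (hn : (0 < n)%N)
  (A : 'M[R]_d) (D : 'I_n -> 'I_n -> {fset 'cV[R]_d})
  (hA : expanding A)
  (hS : primitive_mx (subdivision_mx D))
  (T : 'I_n -> set 'cV[R]_d)
  (hT : multi_tile_equation A D T)
  (hT0 : exists i, T i !=set0)
  (hTc : forall i, compact (T i))
  (hTpos : exists i, (0 < lebesgue_rd (T i))%E) :
  `|\det A| <= perron_eigenvalue (subdivision_mx D).
Proof.
case: d hd A D hA hS T hT hT0 hTc hTpos => // d _ A D _ hS T hT _ hTc [i0 hi0].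
have [l [u [lS u0 Su]]] := primitive_perron hn hS.
rewrite (perron_eigenvalueE lS); set S := subdivision_mx D in hS lS Su *.
pose m i := fine (lebesgue_rd (T i)).
have mE i : lebesgue_rd (T i) = (m i)%:E.
  by rewrite fineK// ge0_fin_numE ?lebesgue_rd_ge0// compact_lebesgue_rd_fin.
have m0 i : 0 <= m i by rewrite -lee_fin -mE lebesgue_rd_ge0.
have mS i : `|\det A| * m i <= \sum_j S j i * m j.
  have := multi_tile_volume_le i hT; rewrite mE -EFinM.
  by under eq_bigr do rewrite mE -EFinM; rewrite sumEFin lee_fin.
have s0 : 0 < \sum_i m i * u i 0.
  rewrite (bigD1 i0)//= ltr_pwDl//; first by rewrite mulr_gt0// -lte_fin -mE.
  by apply: sumr_ge0 => i _; rewrite mulr_ge0// ltW.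
rewrite -(ler_pM2r s0) !mulr_sumr.
apply: (@le_trans _ _ (\sum_i (\sum_j S j i * m j) * u i 0)).
  by apply: ler_sum => i _; rewrite mulrA ler_wpM2r// ltW.
under eq_bigr do rewrite mulr_suml.
rewrite exchange_big /=; apply: ler_sum => j _.
have /(congr1 (fun w : 'cV[R]_n => w j 0)) := Su; rewrite !mxE => Suj.
rewrite mulrCA -Suj mulr_sumr; apply: ler_sum => i _.
by rewrite mulrCA mulrA.
Qed.
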